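(* Let $G$ be a strongly connected finite directed graph without loops (multiple edges allowed), with a fixed sink vertex $s$. Let $RR(G)$ be its rotor-router group and $SP(G)$ its sandpile group. Then $RR(G) \simeq SP(G)$.
   Context: Let $V$ be the vertex set of $G$, let $d_{xy}$ be the number of edges from $x$ to $y$, and $d_x=\sum_y d_{xy}$ the outdegree of $x$. Rotor-router walk: for each vertex $x\ne s$ a cyclic ordering of the edges emanating from $x$ is fixed. A rotor configuration $T$ assigns to each $x\neq s$ an edge $T(x)$ emanating from $x$. In one step, a chip located at $x\neq s$ first causes the rotor $T(x)$ to be incremented to the next edge in the cyclic ordering at $x$, and then moves along this new edge. For a vertex $x$ and a rotor configuration $T$, $e_x(T)$ denotes the rotor configuration resulting from starting a chip at $x$ and letting it walk until it first reaches the sink $s$ (which always happens since $G$ is strongly connected); $e_s$ is the identity. $Rec(G)$ is the set of rotor configurations $T$ such that the edges $\{T(x)\}_{x\neq s}$ contain no directed cycle (equivalently, form an oriented spanning tree rooted at $s$). Each $e_x$ maps $Rec(G)$ bijectively to itself. The rotor-router group $RR(G)$ is the subgroup of the permutation group of $Rec(G)$ generated by $\{e_x\}_{x\neq s}$. The sandpile group is the quotient of the free abelian group $\mathbb{Z}^V$ (with basis $V$) by the subgroup generated by $s$ and the elements $\Delta_x = \sum_{y\in V} d_{xy}\, y - d_x\, x$ for $x\in V$, $x\neq s$. *)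

(* Defs.v *)
From HB Require Import structures.
From mathcomp Require Import all_boot all_order all_fingroup all_algebra.
From mathcomp Require Import boolp.

Set Implicit Arguments.
Unset Strict Implicit.
Unset Printing Implicit Defensive.
Import GRing.Theory.

Record digraph := Digraph {
  vertex :> finType;
  edge : finType;
  src : edge -> vertex;
  tgt : edge -> vertex }.

Definition loopless (G : digraph) : Prop := forall e : edge G, src e != tgt e.

Definition adj (G : digraph) : rel G :=
  [rel x y | [exists e : edge G, (src e == x) && (tgt e == y)]].

Definition strongly_connected (G : digraph) : Prop :=
  forall x y : G, connect (@adj G) x y.

Definition edge_count (G : digraph) (x y : G) : nat :=
  #|[set e : edge G | (src e == x) && (tgt e == y)]|.

Definition outdegree (G : digraph) (x : G) : nat := \sum_y edge_count x y.

Section Sandpile.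

Variables (G : digraph) (s : G).
Local Open Scope ring_scope.

Local Notation vertex_lattice := {ffun G -> int}.

Definition basis_vector (x : G) : vertex_lattice := [ffun y => (y == x)%:R].

Definition toppling (x : G) : vertex_lattice :=
  \sum_y basis_vector y *+ edge_count x y - basis_vector x *+ outdegree x.

Definition sandpile_relator (x : G) : vertex_lattice :=
  if x == s then basis_vector s else toppling x.

Definition sandpile_relations : {pred vertex_lattice} := fun v =>
  `[< exists c : G -> int, v = \sum_x sandpile_relator x *~ c x >].

Lemma sandpile_relations_zmod_closed : zmod_closed sandpile_relations.
Proof.
split=> [|_ _ /asboolP[a ->] /asboolP[b ->]]; apply/asboolP.
  by exists (fun=> 0); rewrite big1.
exists (fun x => a x - b x); rewrite -sumrB.
by apply: eq_bigr => x _; rewrite mulrzBr.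
Qed.

HB.instance Definition _ := GRing.isZmodClosed.Build vertex_lattice
  sandpile_relations sandpile_relations_zmod_closed.

Definition sandpile_group : zmodType := Quotient.quot sandpile_relations.

End Sandpile.

(* The cyclic orderings are given by their successor maps, bundled into one
   permutation of the edges; it is arbitrary on the edges leaving the sink,
   which carries no rotor. *)
Record cyclic_order (G : digraph) (s : G) := CyclicOrder {
  next_edge :> {perm edge G};
  porbit_next_edge : forall e : edge G, src e != s ->
    porbit next_edge e = [set e' | src e' == src e] }.

Section RotorRouter.

Variables (G : digraph) (s : G).

Definition nonsink := {x : G | x != s}.

Record rotor_config := RotorConfig {
  rotor :> {ffun nonsink -> edge G};
  _ : [forall x : nonsink, src (rotor x) == val x] }.

HB.instance Definition _ := [isSub for rotor].
HB.instance Definition _ := [Finite of rotor_config by <:].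

Lemma src_rotor (T : rotor_config) (x : nonsink) : src (T x) = val x.
Proof. by apply/eqP; move: x; apply/forallP; case: T. Qed.

Definition rotor_edge (T : rotor_config) : rel G :=
  [rel x y | [exists z : nonsink, (src (T z) == x) && (tgt (T z) == y)]].

Definition acyclic (T : rotor_config) : bool :=
  [forall x, forall y, rotor_edge T x y ==> ~~ connect (rotor_edge T) y x].

Lemma acyclicP (T : rotor_config) :
  reflect (forall c : seq G, path.cycle (rotor_edge T) c -> c = [::]) (acyclic T).
Proof.
apply: (iffP idP) => [Tac [//|x c] /= cyc | nocyc].
  case: c cyc => [|y c] /=.
    by case/andP=> xx _; have /forallP/(_ x)/implyP/(_ xx) := forallP Tac x;
       rewrite connect0.
  case/andP=> xy yc; have /forallP/(_ y)/implyP/(_ xy)/negP[] := forallP Tac x.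
  by apply/connectP; exists (rcons c x) => //; rewrite last_rcons.
apply/forallP=> x; apply/forallP=> y; apply/implyP=> xy; apply/negP.
case/connectP=> p yp xE.
have: path.cycle (rotor_edge T) (y :: p) by rewrite /= rcons_path yp -xE.
by move/nocyc.
Qed.

Definition Rec := {T : rotor_config | acyclic T}.

Variable rho : cyclic_order s.

Lemma src_next (e : edge G) : src e != s -> src (rho e) = src e.
Proof.
move=> es; have: rho e \in porbit rho e by rewrite -{1}(expg1 (next_edge rho)) mem_porbit.
by rewrite porbit_next_edge // inE => /eqP.
Qed.

Definition advance_fun (T : rotor_config) (x : nonsink) :=
  [ffun z => if z == x then rho (T x) else T z].

Lemma advance_subproof T x :
  [forall z : nonsink, src (advance_fun T x z) == val z].
Proof.
apply/forallP=> z; rewrite ffunE; case: (z =P x) => [->|_].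
  by rewrite src_next ?src_rotor ?(valP x).
by rewrite src_rotor.
Qed.

Definition advance T x : rotor_config := RotorConfig (advance_subproof T x).

(* The chip stays put once it is at the sink. *)
Definition walk_step (st : G * rotor_config) : G * rotor_config :=
  if insub st.1 is Some x
  then let T := advance st.2 x in (tgt (T x), T)
  else st.

Definition walk (x : G) (T : rotor_config) (n : nat) : G * rotor_config :=
  iter n walk_step (x, T).

Lemma advanceE T x z : advance T x z = if z == x then rho (T x) else T z.
Proof. by rewrite ffunE. Qed.

Lemma pigeonhole (S : finType) (f : nat -> S) :
  exists i j, i < j /\ f i = f j.
Proof.
have: ~~ injectiveb (fun k : 'I_#|S|.+1 => f k).
  apply/injectiveP=> /leq_card; by rewrite card_ord ltnn.
case/injectivePn=> i [j ij fij].
have [lt|lt|/val_inj eq] := ltngtP i j.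
- by exists i, j.
- by exists j, i.
- by rewrite eq eqxx in ij.
Qed.

Lemma walk_reaches_sink (Gconn : strongly_connected G) (x : G)
  (T : rotor_config) : exists n, (walk x T n).1 == s.
Proof.
case: (pselect (exists n, (walk x T n).1 == s)) => // nreach; exfalso.
set st := walk x T in nreach.
have stN n : (st n).1 != s by apply/negP=> h; apply: nreach; exists n.
have stS n : st n.+1 = walk_step (st n) by [].
have stE n (y : nonsink) : (st n).1 = val y ->
    st n.+1 = (tgt (advance (st n).2 y y), advance (st n).2 y).
  by move=> yE; rewrite stS /walk_step yE valK.
have [i [j [ij ijE]]] := pigeonhole st.
have per n : i <= n -> st (n + (j - i)) = st n.
  move=> le; rewrite -(subnK le); elim: (n - i) => [|k IH].
    by rewrite !add0n subnKC // ltnW.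
  by rewrite !addSn !stS IH.
pose Q (y : nonsink) e :=
  exists n, [/\ i <= n, (st n).1 = val y & (st n.+1).2 y = e].
have Qnext y e : Q y e -> Q y (rho e).
  case=> n [len ny nE].
  have ex : exists m, (n < m) && ((st m).1 == val y).
    exists (n + (j - i)); rewrite per // ny eqxx andbT -addn1 leq_add2l.
    by rewrite subn_gt0.
  case: (ex_minnP ex) => m /andP[nm /eqP my] mmin.
  have const k : n < k -> k <= m -> (st k).2 y = e.
    elim: k => // k IH; rewrite ltnS leq_eqVlt => /orP[/eqP<- //|nk] km.
    have ky : (st k).1 != val y.
      by apply/negP=> h; have := mmin k; rewrite nk h leqNgt km => /(_ isT).
    rewrite (stE k (exist _ (st k).1 (stN k) : nonsink)) //= advanceE; case: eqP => [yE|_].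
      by case/eqP: ky; rewrite yE.
    by apply: IH => //; apply: ltnW.
  exists m; split=> //; first exact: leq_trans len (ltnW nm).
  by rewrite (stE _ _ my) /= advanceE eqxx const.
pose A y := exists n, i <= n /\ (st n).1 = y.
have Aadj y z : A y -> adj y z -> A z.
  case=> n [len ny] /existsP[e /andP[/eqP ey /eqP <-]].
  have ys : y != s by rewrite -ny.
  pose y' : nonsink := exist _ y ys.
  have Q0 : Q y' ((st n.+1).2 y') by exists n.
  have: e \in porbit rho ((st n.+1).2 y').
    by rewrite porbit_next_edge ?inE ?src_rotor //= ey.
  case/porbitP=> k eE.
  have [m [lem my mE]] : Q y' e.
    rewrite eE; elim: (k) => [|l IH]; first by rewrite expg0 perm1.
    by rewrite expgSr permM; apply: Qnext.
  exists m.+1; split; first exact: leqW.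
  by move: mE; rewrite (stE _ _ my) /= => ->.
have [n [_ ns]] : A s.
  have /connectP[p] := Gconn (st i).1 s.
  have: A (st i).1 by exists i.
  elim: p (st i).1 => /= [|z p IH] y Ay; first by move=> _ ->.
  by case/andP=> yz; apply: IH; apply: Aadj yz.
by have := stN n; rewrite ns eqxx.
Qed.

Variable Gconn : strongly_connected G.

Definition walk_time x T : nat := ex_minn (walk_reaches_sink Gconn x T).

Definition chip_op (x : G) (T : rotor_config) : rotor_config :=
  (walk x T (walk_time x T)).2.

(* To see that chip_op x permutes Rec, add an edge from s back to x: the walk
   becomes an injection on the pairs (z, T) in which every vertex can be led
   to z by the rotors. *)
Section Unicycle.

Variable x : G.

Let rnext (T : rotor_config) (u : G) : G :=
  if insub u is Some y then tgt (T y) else x.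

Let good (st : G * rotor_config) := forall u, exists n, iter n (rnext st.2) u = st.1.

Let ustep (st : G * rotor_config) : G * rotor_config :=
  if insub st.1 is Some y
  then let T := advance st.2 y in (tgt (T y), T)
  else (x, st.2).

Let ustep_pos st : (ustep st).1 = rnext (ustep st).2 st.1.
Proof. by rewrite /ustep /rnext; case: insubP => [y _ yE|_] //=; rewrite -?yE ?valK. Qed.

Let ustep_rnext st u : u != st.1 -> rnext (ustep st).2 u = rnext st.2 u.
Proof.
rewrite /ustep /rnext; case: (insubP nonsink st.1) => [y _ yE|_] //= uy.
case: insubP => //= z _ zE; rewrite advanceE; case: eqP => // zy.
by rewrite -zE zy yE eqxx in uy.
Qed.

Let good_ustep_old st : good st ->
  forall u, exists n, iter n (rnext (ustep st).2) u = st.1.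
Proof.
move=> gst u; have [n] := gst u; elim: n u => [|n IH] u; first by exists 0.
rewrite iterSr; have [-> _|us] := eqVneq u st.1; first by exists 0.
by rewrite -(ustep_rnext us) => /IH[m mE]; exists m.+1; rewrite iterSr.
Qed.

Let good_ustep st : good st -> good (ustep st).
Proof.
move=> /good_ustep_old gst u; have [n nE] := gst u.
by exists n.+1; rewrite iterS nE ustep_pos.
Qed.

Let ustep_inj st1 st2 : good st1 -> good st2 -> ustep st1 = ustep st2 -> st1 = st2.
Proof.
move=> g1 g2 eq12.
have posE : st1.1 = st2.1.
  have [a aE] := good_ustep_old g1 (ustep st1).1.
  have [b] := good_ustep_old g2 (ustep st1).1; rewrite -eq12 => bE.
  have per k c : iter c.+1 (rnext (ustep st1).2) (ustep st1).1 = (ustep st1).1 ->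
      iter (k * c.+1) (rnext (ustep st1).2) (ustep st1).1 = (ustep st1).1.
    by move=> cE; elim: k => // k IH; rewrite mulSn iterD IH.
  have pa := per b a; have pb := per a b.
  rewrite iterS aE -ustep_pos in pa; rewrite iterS bE in pb.
  have e2 : rnext (ustep st1).2 st2.1 = (ustep st1).1 by rewrite eq12 -ustep_pos.
  rewrite -aE -bE -{1}pa // -{2}pb // -!iterD.
  by congr iter; rewrite !mulnS addnCA (mulnC b).
case: st1 st2 posE eq12 {g1 g2} => z1 T1 [z2 T2] /= <-.
rewrite /ustep /=; case: insubP => [y _ _|_]; last by case=> ->.
move/(congr1 (fun st => rotor st.2)) => /= /ffunP eqf.
congr pair; apply/val_inj/ffunP=> z /=; have := eqf z.
by rewrite !ffunE; case: eqP => // -> /perm_inj.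
Qed.

Let good_sinkP T : reflect (good (s, T)) (acyclic T).
Proof.
have sinkN y z : rotor_edge T y z -> (y != s) && (rnext T y == z).
  case/existsP=> w /andP[/eqP <- /eqP <-].
  by rewrite src_rotor (valP w) /rnext valK eqxx.
have edge_rnext y : y != s -> rotor_edge T y (rnext T y).
  move=> ys; apply/existsP; exists (exist _ y ys : nonsink).
  by rewrite src_rotor /= eqxx /rnext insubT eqxx.
apply: (iffP idP) => [/acyclicP Tac u | gT].
  case: (pselect (exists n, iter n (rnext T) u = s)) => // nreach; exfalso.
  pose v n := iter n (rnext T) u.
  have vN n : v n != s by apply/negP=> /eqP h; apply: nreach; exists n.
  have [i [j [ij ijE]]] := pigeonhole v.
  have vpath k n : path (rotor_edge T) (v k) [seq v m | m <- iota k.+1 n].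
    by elim: n k => //= n IH k; apply/andP; split; [exact: edge_rnext | exact: IH].
  have := Tac [seq v m | m <- iota i.+1 (j - i)].
  have: 0 < j - i by rewrite subn_gt0.
  case dE: (j - i) => [//|d] _ /= H; suff: false by [].
  suff /H : path (rotor_edge T) (v i.+1) (rcons [seq v m | m <- iota i.+2 d] (v i.+1)) by [].
  rewrite rcons_path vpath.
  have -> : last (v i.+1) [seq v m | m <- iota i.+2 d] = v j.
    have lastE k l : last k (iota k.+1 l) = k + l.
      by elim: l k => [|l IH] k /=; rewrite ?addn0 // IH addSnnS.
    by rewrite last_map lastE addSnnS -dE subnKC // ltnW.
  by rewrite -ijE edge_rnext.
apply/acyclicP=> [[//|y c]] cyc; exfalso.
have stay z : z \in y :: c -> (z != s) && (rnext T z \in y :: c).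
  move=> zc; have /sinkN := next_cycle cyc zc.
  by case/andP=> -> /eqP ->; rewrite mem_next.
have [n nE] := gT y.
have: iter n (rnext T) y \in y :: c.
  by elim: (n) => [|k IH]; [exact: mem_head | case/andP: (stay _ IH)].
by rewrite nE /= => /stay; rewrite eqxx.
Qed.

Let iter_ustep T n : n <= walk_time x T ->
  iter n.+1 ustep (s, T) = walk x T n.
Proof.
elim: n => [_|n IH lt]; first by rewrite /= /ustep /= insubF ?eqxx.
rewrite iterS IH 1?ltnW // /walk iterS -/(walk x T n) /ustep /walk_step.
case: insubP => // /negPn ns; move: lt; rewrite /walk_time.
by case: ex_minnP => m _ /(_ _ ns); rewrite leqNgt => /negPf->.
Qed.

Let first_return T :
  iter (walk_time x T).+1 ustep (s, T) = (s, chip_op x T).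
Proof.
rewrite iter_ustep // [LHS]surjective_pairing; congr pair.
by rewrite /walk_time; case: ex_minnP => m /eqP.
Qed.

Let no_early_return T n : n < walk_time x T ->
  (iter n.+1 ustep (s, T)).1 != s.
Proof.
move=> lt; rewrite iter_ustep 1?ltnW //; apply/negP=> ns; move: lt.
by rewrite /walk_time; case: ex_minnP => m _ /(_ _ ns); rewrite leqNgt => /negPf->.
Qed.

Let good_iter st n : good st -> good (iter n ustep st).
Proof. by move=> gst; elim: n => //= n; apply: good_ustep. Qed.

Lemma chip_op_acyclic T : acyclic T -> acyclic (chip_op x T).
Proof.
by move/good_sinkP=> gT; apply/good_sinkP; rewrite -first_return; apply: good_iter.
Qed.

Lemma chip_op_inj : {in @acyclic &, injective (chip_op x)}.
Proof.
move=> T1 T2 /good_sinkP g1 /good_sinkP g2 eq12.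
wlog le: T1 T2 g1 g2 eq12 / walk_time x T1 <= walk_time x T2.
  by move=> wl; case/orP: (leq_total (walk_time x T1) (walk_time x T2)) => le;
     [|symmetry]; apply: wl.
have back n st1 st2 : good st1 -> good st2 ->
    iter n ustep st1 = iter n ustep st2 -> st1 = st2.
  by elim: n st1 st2 => //= n IH st1 st2 h1 h2 /ustep_inj eq;
     apply: (IH) => //; apply: eq; apply: good_iter.
have := first_return T1; rewrite eq12 -first_return -(subnK le) -addnS addnC iterD.
move/back=> /(_ g1 (good_iter _ g2)).
case dE: (walk_time x T2 - walk_time x T1) => [|d]; first by case.
move/(congr1 fst) => /= /esym /eqP; rewrite -/(iter d.+1 ustep (s, T2)).
by apply: contraTeq => _; apply: no_early_return; rewrite -dE leq_subr.
Qed.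

Definition chip_op_Rec (T : Rec) : Rec :=
  Sub (chip_op x (val T)) (chip_op_acyclic (valP T)).

Lemma chip_op_Rec_inj : injective chip_op_Rec.
Proof. by move=> T1 T2 [/chip_op_inj eq12]; apply/val_inj/eq12; apply: valP. Qed.

Definition chip_op_perm : {perm Rec} := perm chip_op_Rec_inj.

End Unicycle.

Definition rotor_router_group : {group {perm Rec}} :=
  <<[set chip_op_perm x | x in predC1 s]>>%G.

End RotorRouter.

(* Main.v *)
(* Fix an acyclic configuration B and record how many turns lead from B(x) to
   T(x) at each x <> s. Adding x - tgt(e) for each edge e turned to defines a
   potential of T with values in the sandpile group: a full turn at x contributes
   -Delta_x, which vanishes there. A step of the walk preserves the sum of the
   potential and of the position of the chip, so e_x translates the potential by
   the class of x.

   The potential is injective on acyclic configurations. If T and T' have the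
   same potential, adding full turns gives p and q turns from B to T and T' whose
   chip movements agree away from s. Then the set of x with p(x) < q(x) has
   T'(x) staying inside it for all its x, so it is empty as T' is acyclic;
   exchanging T and T' gives p = q.

   Hence an element of the rotor-router group is determined by the translation
   that it induces, and all translations occur. *)

Require Import Defs.
From HB Require Import structures.
From mathcomp Require Import all_boot all_order all_fingroup all_algebra.
From mathcomp Require Import boolp.

Set Implicit Arguments.
Unset Strict Implicit.
Unset Printing Implicit Defensive.
Import Order.TTheory GRing.Theory Num.Theory.

Local Open Scope ring_scope.

(** * Signed chip moves along edges and their content in a vertex set *)

Section Boundary.

Variable G : digraph.

(** Source minus target, so that the position of a chip plus the boundaries of the edges it has
    taken stays constant. *)
Definition edge_boundary (e : edge G) : {ffun G -> int} :=
  basis_vector (src e) - basis_vector (tgt e).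

Lemma toppling_boundary (x : G) :
  toppling x = - \sum_(e : edge G | src e == x) edge_boundary e.
Proof.
rewrite /toppling /edge_boundary sumrB opprB; congr (_ - _).
  rewrite (partition_big (fun e => tgt e) xpredT) //=; apply: eq_bigr => y _.
  rewrite (eq_bigr (fun=> basis_vector y)) => [|e /andP[_ /eqP->]] //.
  by rewrite sumr_const; congr (_ *+ _); apply: eq_card => e; rewrite !inE.
rewrite (eq_bigr (fun=> basis_vector x)) => [|e /eqP->] //.
rewrite sumr_const /outdegree -sum1_card; congr (_ *+ _).
rewrite (partition_big (fun e => tgt e) xpredT) //=; apply: eq_bigr => y _.
by rewrite sum1_card /edge_count; apply: eq_card => e; rewrite !inE.
Qed.

Definition content (U : pred G) (u : {ffun G -> int}) : int := \sum_(y | U y) u y.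

Lemma content_is_zmod_morphism U : zmod_morphism (content U).
Proof. by move=> u v; rewrite /content -sumrB; apply: eq_bigr => y _; rewrite !ffunE. Qed.

HB.instance Definition _ U :=
  GRing.isZmodMorphism.Build _ _ (content U) (content_is_zmod_morphism U).

Lemma content_boundary U e :
  content U (edge_boundary e) = (U (src e))%:R - (U (tgt e))%:R.
Proof.
have contentE x : content U (basis_vector x) = (U x)%:R.
  rewrite /content; case Ux: (U x).
    rewrite (bigD1 x) //= ffunE eqxx big1 ?addr0 // => y /andP[_ /negPf yx].
    by rewrite ffunE yx.
  rewrite big1 // => y Uy; rewrite ffunE; case: eqP => // yx.
  by rewrite -yx Uy in Ux.
by rewrite raddfB /= !contentE.
Qed.

End Boundary.

(** * Sums of the chip moves caused by turning rotors *)

Section Turns.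

Variables (G : digraph) (s : G) (rho : cyclic_order s).
Implicit Types (e : edge G) (T B : rotor_config s) (x : nonsink s).

(** A chip leaves along the edge just turned to, so the sum starts at [rho e] and not at [e]. *)
Definition turn_sum e n : {ffun G -> int} :=
  \sum_(j < n) edge_boundary (iter j.+1 rho e).

Lemma turn_sumD e m n :
  turn_sum e (m + n) = turn_sum e m + turn_sum (iter m rho e) n.
Proof.
rewrite /turn_sum big_split_ord; congr (_ + _); apply: eq_bigr => j _ /=.
by rewrite addnC iterD.
Qed.

Lemma turn_sumS e n :
  turn_sum e n.+1 = turn_sum e n + edge_boundary (iter n.+1 rho e).
Proof. by rewrite /turn_sum big_ord_recr. Qed.

Lemma src_iter e n : src e != s -> src (iter n rho e) = src e.
Proof. by move=> es; elim: n => //= n IH; rewrite src_next ?IH. Qed.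

(** A full turn passes exactly once through each edge leaving [src e]. *)
Lemma turn_sum_full e : src e != s ->
  turn_sum e #|porbit rho e| = - toppling (src e).
Proof.
move=> es; rewrite toppling_boundary opprK.
have es' : src (rho e) != s by rewrite src_next.
transitivity (\sum_(e' <- traject rho (rho e) #|porbit rho (rho e)|) edge_boundary e').
  rewrite (big_nth e) size_traject big_mkord.
  have -> : porbit rho (rho e) = porbit rho e by rewrite !porbit_next_edge ?src_next.
  apply: eq_bigr => j _; rewrite (set_nth_default (rho e)) ?size_traject //.
  by rewrite nth_traject // -iterSr.
rewrite big_uniq ?uniq_traject_porbit //=; apply: eq_bigl => e'.
by rewrite -porbit_traject porbit_next_edge // inE src_next.
Qed.

Lemma turn_sum_rounds e n k : src e != s ->
  turn_sum e (n + k * #|porbit rho e|) = turn_sum e n - toppling (src e) *+ k.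
Proof.
move=> es; elim: k => [|k IH]; first by rewrite mul0n addn0 mulr0n subr0.
rewrite mulSnr addnA turn_sumD IH mulrSr opprD addrA; congr (_ + _).
(* The last round starts at another edge of the same orbit, so it has the same length. *)
set m := (n + _)%N; have := @turn_sum_full (iter m rho e).
by rewrite -permX porbit_perm permX src_iter //; apply.
Qed.

Lemma iter_rounds e n k : iter (n + k * #|porbit rho e|) rho e = iter n rho e.
Proof.
elim: k => [|k IH]; first by rewrite addn0.
by rewrite mulSnr addnA iterD iter_porbit.
Qed.

Lemma iter_eq_mod e m n : iter m rho e = iter n rho e ->
  (m = n %[mod #|porbit rho e|])%N.
Proof.
set d := #|_|; have d0 : (0 < d)%N by rewrite lt0n card_porbit_neq0.
have modE k : iter k rho e = nth e (traject rho e d) (k %% d).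
  by rewrite {1}(divn_eq k d) addnC iter_rounds nth_traject ?ltn_mod.
rewrite !modE => /eqP.
by rewrite nth_uniq ?size_traject ?ltn_mod ?uniq_traject_porbit // => /eqP.
Qed.

(* A turn of a rotor in [U] moves a chip out of [U] or within [U], and a turn
   of a rotor outside [U] can only bring a chip into [U]. *)
Lemma content_turn_sum_ge (U : pred G) e n : src e != s -> U (src e) ->
  (~~ U (tgt (iter n.+1 rho e)))%:R <= content U (turn_sum e n.+1).
Proof.
move=> es Ue; rewrite turn_sumS raddfD /= content_boundary src_next ?src_iter // Ue.
rewrite -[leLHS]add0r lerD //; last by case: (U _).
rewrite raddf_sum /= sumr_ge0 // => j _.
by rewrite content_boundary /= src_next ?src_iter // Ue; case: (U _).
Qed.

Lemma content_turn_sum_le (U : pred G) e n : src e != s -> ~~ U (src e) ->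
  content U (turn_sum e n) <= 0.
Proof.
move=> es /negPf Ue; rewrite raddf_sum /= sumr_le0 // => j _.
by rewrite content_boundary /= src_next ?src_iter // Ue; case: (U _).
Qed.

(** Following the rotors from a vertex of [U] never leaves [U], hence never reaches [s]; by
    finiteness some vertex recurs, which gives a directed cycle. *)
Lemma acyclic_closed0 T (U : pred G) : acyclic T -> ~~ U s ->
  (forall x, U (val x) -> U (tgt (T x))) -> U =1 xpred0.
Proof.
move=> Tac Us Ucl u; apply/negP=> Uu.
pose next v := if insub v is Some x then tgt (T x) else v.
have edge_next v : U v -> U (next v) && rotor_edge T v (next v).
  move=> Uv; have vs : v != s by apply: contraTneq Uv => ->.
  rewrite /next insubT /= (Ucl (Sub v vs)) //=; apply/existsP; exists (Sub v vs).
  by rewrite src_rotor /= !eqxx.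
have Un n : U (iter n next u) by elim: n => //= n /edge_next/andP[].
have conn m n : connect (rotor_edge T) (iter m next u) (iter (n + m) next u).
  elim: n => //= n IH; apply: connect_trans IH (connect1 _).
  by case/andP: (edge_next _ (Un (n + m)%N)).
have [i [j [ij ijE]]] := pigeonhole (fun n => iter n next u).
have /andP[_ ee] := edge_next _ (Un i).
have /implyP/(_ ee)/negP[] := forallP (forallP Tac (iter i next u)) (iter i.+1 next u).
by rewrite [X in connect _ _ X]ijE -(subnK ij) conn.
Qed.

(* The set of vertices whose rotor turns more often in [q] than in [p] is
   closed under [T']: passing from [p] to [q], no turn can increase
   its content, which must be unchanged, so the last move of each of its rotors
   stays inside. *)
Lemma balanced_turns_le B T' (p q : nonsink s -> nat) : acyclic T' ->
  (forall x, T' x = iter (q x) rho (B x)) ->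
  (forall y, y != s ->
     (\sum_x turn_sum (B x) (q x) - \sum_x turn_sum (B x) (p x)) y = 0) ->
  forall x, (q x <= p x)%N.
Proof.
move=> T'ac T'E bal.
pose U : pred G := fun y => if insub y is Some x then (p x < q x)%N else false.
have UE (x : nonsink s) : U (val x) = (p x < q x)%N by rewrite /U valK.
have Us : ~~ U s by rewrite /U insubF ?eqxx.
have Bis x n : src (iter n rho (B x)) = val x.
  by rewrite src_iter src_rotor ?(valP x).
pose loss x := content U (turn_sum (B x) (q x) - turn_sum (B x) (p x)).
have loss_ge x : ((p x < q x)%N && ~~ U (tgt (T' x)))%:R <= loss x.
  rewrite /loss; case: ltnP => /= [lt|le].
    (* The first [p x] turns cancel; of the remaining ones, the last reaches [T' x]. *)
    rewrite -{1}(subnKC (ltnW lt)) turn_sumD addrC addKr T'E.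
    rewrite -[in iter _ _ _](subnK (ltnW lt)) iterD.
    case dE: (q x - p x)%N => [|n]; first by move: lt; rewrite -subn_gt0 dE.
    by rewrite content_turn_sum_ge ?Bis ?(valP x) ?UE.
  rewrite -(subnKC le) turn_sumD opprD addNKr raddfN /= oppr_ge0.
  by rewrite content_turn_sum_le ?Bis ?(valP x) // UE -leqNgt.
(* The losses sum to the content of a vector supported at [s], which lies outside [U]. Being
   nonnegative, they all vanish. *)
have loss0 x : loss x = 0.
  have total : \sum_x loss x = 0.
    rewrite -raddf_sum /= sumrB /content big1 // => y Uy; apply: bal.
    by apply: contraTneq Uy => ->.
  by apply: (psumr_eq0P (P := xpredT)) total _ _ => // y _; apply: le_trans (loss_ge y).
have U0 : U =1 xpred0.
  apply: (acyclic_closed0 T'ac Us) => x; rewrite UE => lt.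
  by have := loss_ge x; rewrite loss0 lt; case: (U _).
by move=> x; have := U0 (val x); rewrite UE => /negbT; rewrite -leqNgt.
Qed.

End Turns.

(** * Classes in the sandpile group *)

Section SandpileClass.

Variables (G : digraph) (s : G).

Definition sandpile_class (u : {ffun G -> int}) : sandpile_group s :=
  (\pi_(sandpile_group s) u)%qT.

Lemma sandpile_class_is_zmod_morphism : zmod_morphism sandpile_class.
Proof. exact: (raddfB \pi_(sandpile_group s)%qT). Qed.

HB.instance Definition _ := GRing.isZmodMorphism.Build _ _ sandpile_class
  sandpile_class_is_zmod_morphism.

Lemma sandpile_class_surj v : exists u, v = sandpile_class u.
Proof. by exists (generic_quotient.repr v); rewrite -[LHS](reprK v). Qed.

Lemma sandpile_class_eq u v : sandpile_class u = sandpile_class v <->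
  exists c : G -> int, u - v = \sum_x sandpile_relator s x *~ c x.
Proof.
have := Quotient.idealrBE (sandpile_relations s) u v.
rewrite -[sandpile_class u]/(\pi_(sandpile_group s) u)%qT.
rewrite -[sandpile_class v]/(\pi_(sandpile_group s) v)%qT => uvE.
split=> [/eqP | rel]; first by rewrite -uvE => /asboolP.
by apply/eqP; rewrite -uvE; apply/asboolP.
Qed.

Lemma sandpile_class_relator x : sandpile_class (sandpile_relator s x) = 0.
Proof.
rewrite -(raddf0 sandpile_class); apply/sandpile_class_eq.
exists (fun y => (y == x)%:R); rewrite subr0 (bigD1 x) //= eqxx mulr1z.
by rewrite big1 ?addr0 // => y /negPf->.
Qed.

Lemma sandpile_class_sink : sandpile_class (basis_vector s) = 0.
Proof. by have := sandpile_class_relator s; rewrite /sandpile_relator eqxx. Qed.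

Lemma sandpile_class_toppling x : x != s -> sandpile_class (toppling x) = 0.
Proof.
by move=> /negPf xs; have := sandpile_class_relator x; rewrite /sandpile_relator xs.
Qed.

Lemma sandpile_classE u :
  sandpile_class u = \sum_x sandpile_class (basis_vector x) *~ u x.
Proof.
rewrite (eq_bigr (fun x => sandpile_class (basis_vector x *~ u x))); last first.
  by move=> x _; rewrite raddfMz.
rewrite -raddf_sum; congr sandpile_class; apply/ffunP=> y.
rewrite sum_ffunE (bigD1 y) //= big1 => [|x /negPf xy].
  by rewrite ffunMzE ffunE eqxx intz addr0.
by rewrite ffunMzE ffunE eq_sym xy mul0rz.
Qed.

End SandpileClass.

(** * The potential of a rotor configuration *)

Section Potential.

Variables (G : digraph) (s : G) (rho : cyclic_order s) (B : rotor_config s).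
Implicit Types (T : rotor_config s) (x : nonsink s).

Lemma rotor_turns_ex T x : exists n, T x == iter n rho (B x).
Proof.
have: T x \in porbit rho (B x).
  by rewrite porbit_next_edge ?src_rotor ?(valP x) // inE src_rotor.
by case/porbitP=> n; rewrite permX => /eqP; exists n.
Qed.

(** A chosen count, determined by [T] only up to full turns. *)
Definition rotor_turns T x : nat := xchoose (rotor_turns_ex T x).

Lemma rotor_turnsE T x : T x = iter (rotor_turns T x) rho (B x).
Proof. by apply/eqP; apply: (xchooseP (rotor_turns_ex T x)). Qed.

Definition potential T : sandpile_group s :=
  sandpile_class s (\sum_x turn_sum rho (B x) (rotor_turns T x)).

(** Two counts leading to the same edge agree modulo the orbit length, and full turns contribute
    multiples of a toppling, whose class is zero. *)
Lemma potential_turns T (p : nonsink s -> nat) :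
  (forall x, T x = iter (p x) rho (B x)) ->
  potential T = sandpile_class s (\sum_x turn_sum rho (B x) (p x)).
Proof.
move=> TE; rewrite /potential !raddf_sum /=; apply: eq_bigr => x _.
have Bs : src (B x) != s by rewrite src_rotor (valP x).
have redE n : sandpile_class s (turn_sum rho (B x) n) =
    sandpile_class s (turn_sum rho (B x) (n %% #|porbit rho (B x)|)).
  rewrite {1}(divn_eq n #|porbit rho (B x)|) addnC turn_sum_rounds // raddfB raddfMn.
  by rewrite /= sandpile_class_toppling // mul0rn subr0.
rewrite redE [RHS]redE; congr (sandpile_class _ (turn_sum _ _ _)).
by apply: iter_eq_mod; rewrite -rotor_turnsE.
Qed.

Lemma potential_advance T x :
  potential (advance rho T x) =
  potential T + sandpile_class s (edge_boundary (advance rho T x x)).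
Proof.
rewrite (@potential_turns _ (fun z => if z == x then (rotor_turns T x).+1 else rotor_turns T z)).
  rewrite (bigD1 x) //= eqxx turn_sumS addrAC raddfD /=; congr (_ + _); last first.
    by rewrite advanceE eqxx -rotor_turnsE.
  rewrite /potential [in RHS](bigD1 x) //=; congr (sandpile_class _ (_ + _)).
  by apply: eq_bigr => z /negPf->.
by move=> z; rewrite advanceE; case: eqP => [->|_]; rewrite ?iterS -rotor_turnsE.
Qed.

Lemma potential_walk (x : G) T n :
  sandpile_class s (basis_vector (walk rho x T n).1) + potential (walk rho x T n).2 =
  sandpile_class s (basis_vector x) + potential T.
Proof.
elim: n => // n <-; rewrite /walk iterS -/(walk rho x T n) /walk_step.
case: insubP => [y _ yE|//] /=; rewrite potential_advance /edge_boundary src_rotor yE.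
by rewrite raddfB /= addrCA [X in _ + X]addrC subrK addrC.
Qed.

(** The walk ends at [s], whose class is zero, so the class of the starting vertex passes into the
    potential. *)
Lemma potential_chip_op (Gconn : strongly_connected G) (x : G) T :
  potential (chip_op rho Gconn x T) = potential T + sandpile_class s (basis_vector x).
Proof.
rewrite addrC -(potential_walk x T (walk_time rho Gconn x T)) /chip_op.
rewrite /walk_time; case: ex_minnP => m /eqP -> _.
by rewrite sandpile_class_sink add0r.
Qed.

Lemma balanced_turns_ex T T' : potential T = potential T' ->
  exists p q : nonsink s -> nat,
    [/\ forall x, T x = iter (p x) rho (B x),
        forall x, T' x = iter (q x) rho (B x) &
        forall y, y != s ->
          (\sum_x turn_sum rho (B x) (p x) - \sum_x turn_sum rho (B x) (q x)) y = 0].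
Proof.
case/sandpile_class_eq=> c cE.
pose d x := #|porbit rho (B x)|.
(* [m] and [n] are the positive and negative parts of [c]. A full turn subtracts a toppling, so [m]
   rounds added to [T] and [n] to [T'] cancel the relation up to a multiple of [s]. *)
pose m (x : G) := if c x is Posz k then k else 0%N.
pose n (x : G) := if c x is Negz k then k.+1 else 0%N.
have cmn (y : G) : c y = (m y)%:Z - (n y)%:Z.
  by rewrite /m /n; case: (c y) => k; rewrite ?subr0 // NegzE sub0r.
exists (fun x => rotor_turns T x + m (val x) * d x)%N.
exists (fun x => rotor_turns T' x + n (val x) * d x)%N.
split=> [x|x|y ys]; rewrite ?iter_rounds -?rotor_turnsE //.
have Bs x : src (B x) != s by rewrite src_rotor (valP x).
have sumE (t : nonsink s -> nat) (k : G -> nat) :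
    \sum_x turn_sum rho (B x) (t x + k (val x) * d x)%N =
    \sum_x turn_sum rho (B x) (t x) - \sum_(y | y != s) toppling y *+ k y.
  rewrite [in RHS](big_sub (fun y => y != s)) -sumrB; apply: eq_bigr => x _.
  by rewrite turn_sum_rounds // src_rotor.
have relE : \sum_z sandpile_relator s z *~ c z = basis_vector s *~ c s +
    (\sum_(z | z != s) toppling z *+ m z - \sum_(z | z != s) toppling z *+ n z).
  rewrite (bigD1 s) //= {1}/sandpile_relator eqxx -sumrB; congr (_ + _).
  by apply: eq_bigr => z /negPf zs; rewrite /sandpile_relator zs cmn mulrzBr !pmulrn.
rewrite !sumE opprB [X in _ + X]addrC addrACA cE relE -addrA [X in _ + (_ + X)]addrC.
by rewrite -[X in _ + (_ + X)]opprB subrr addr0 ffunMzE ffunE (negPf ys) mul0rz.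
Qed.

Lemma potential_inj : {in @acyclic G s &, injective potential}.
Proof.
move=> T T' Tac T'ac /balanced_turns_ex[p [q [TE T'E bal]]].
apply/val_inj/ffunP=> x /=; rewrite TE T'E; congr iter; apply/eqP.
rewrite eqn_leq (balanced_turns_le Tac TE bal) (balanced_turns_le T'ac T'E) // => y ys.
by rewrite -opprB ffunE bal // oppr0.
Qed.

End Potential.

(** * A base configuration and the isomorphism *)

Lemma acyclic_ex (G : digraph) (s : G) : strongly_connected G ->
  exists B : rotor_config s, acyclic B.
Proof.
move=> Gconn.
(* Each rotor is pointed at a vertex at smaller directed distance to [s], so the rotors cannot close
   a cycle. *)
pose reach n (y : G) := `[< exists p, [/\ path (@adj G) y p, last y p = s & size p = n] >].
have reach_ex y : exists n, reach n y.
  by have /connectP[p py sE] := Gconn y s; exists (size p); apply/asboolP; exists p.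
pose dist y := ex_minn (reach_ex y).
have closer (x : nonsink s) : exists e : edge G, (src e == val x) && (dist (tgt e) < dist (val x))%N.
  rewrite /dist; case: ex_minnP => n /asboolP[[|z p] [/= yp sE <-]] _.
    by case/eqP: (valP x).
  case/andP: yp => /existsP[e /andP[ex /eqP ez]] zp; exists e; rewrite ex ez.
  by case: ex_minnP => k _; apply; apply/asboolP; exists p.
pose b := [ffun x => xchoose (closer x)].
have srcb : [forall x : nonsink s, src (b x) == val x].
  by apply/forallP=> x; rewrite ffunE; case/andP: (xchooseP (closer x)).
exists (RotorConfig srcb).
have dist_edge y z : rotor_edge (RotorConfig srcb) y z -> (dist z < dist y)%N.
  case/existsP=> x /andP[/eqP <- /eqP <-] /=; rewrite ffunE.
  by case/andP: (xchooseP (closer x)) => /eqP->.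
apply/forallP=> y; apply/forallP=> z; apply/implyP=> /dist_edge lt.
apply/negP=> /connectP[p]; elim: p z lt => [|w p IH] z lt /=.
  by move=> _ yz; rewrite yz ltnn in lt.
by case/andP=> /dist_edge wz; apply: IH; apply: ltn_trans lt.
Qed.

Theorem theorem2p5 (G : digraph) (Gloopless : loopless G)
    (Gconn : strongly_connected G) (s : G) (rho : cyclic_order s) :
  exists f : sandpile_group s -> [subg rotor_router_group rho Gconn],
    {morph f : a b / (a + b)%R >-> (a * b)%g} /\ bijective f.
Proof.
have [B Bac] := acyclic_ex s Gconn.
pose B0 : Rec s := Sub B Bac.
pose pot (T : Rec s) := potential rho B (val T).
have pot_inj : injective pot.
  by move=> T T' /potential_inj TT'; apply/val_inj/TT'; apply: valP.
(* This relation will be shown to be the graph of the isomorphism when [g] ranges over the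
   rotor-router group. *)
pose shifts (g : {perm Rec s}) v := forall T, pot (g T) = pot T + v.
have shifts_perm g h v : shifts g v -> shifts h v -> g = h.
  by move=> gv hv; apply/permP=> T; apply: pot_inj; rewrite gv hv.
(* One configuration, here [B0], suffices to read off the translation. *)
have shifts_class g v w : shifts g v -> shifts g w -> v = w.
  by move=> gv gw; apply: (addrI (pot B0)); rewrite -gv gw.
have shifts1 : shifts 1%g 0 by move=> T; rewrite perm1 addr0.
have shiftsM g h v w : shifts g v -> shifts h w -> shifts (g * h)%g (v + w).
  by move=> gv hw T; rewrite permM hw gv addrA.
have shiftsV g v : shifts g v -> shifts g^-1%g (- v).
  by move=> gv T; apply: (addIr v); rewrite subrK -gv permKV.
have shifts_chip x : shifts (chip_op_perm rho Gconn x) (sandpile_class s (basis_vector x)).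
  by move=> T; rewrite permE /pot /= potential_chip_op.
pose RR := rotor_router_group rho Gconn.
have RR_class v : exists g : [subg RR], shifts (val g) v.
  suff [g gRR gv] : exists2 g, g \in RR & shifts g v.
    by exists (subg RR g); rewrite subgK.
  have [u ->] := sandpile_class_surj v.
  rewrite sandpile_classE; elim/big_ind: _ => [|v1 v2 [g1 R1 S1] [g2 R2 S2]|x _].
  - by exists 1%g; rewrite ?group1.
  - by exists (g1 * g2)%g; [rewrite groupM | apply: shiftsM].
  have [g gRR gx] : exists2 g, g \in RR & shifts g (sandpile_class s (basis_vector x)).
    (* The sink gives no generator, but its class is zero and the identity serves. *)
    have [->|xs] := eqVneq x s; first by exists 1%g; rewrite ?sandpile_class_sink ?group1.
    by exists (chip_op_perm rho Gconn x); first by apply/mem_gen/imset_f.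
  have expS n : shifts (g ^+ n)%g (sandpile_class s (basis_vector x) *+ n).
    elim: n => // n IH; rewrite expgS mulrS; exact: shiftsM.
  case: (u x) => n; first by exists (g ^+ n)%g; [rewrite groupX | apply: expS].
  by exists (g ^+ n.+1)^-1%g; [rewrite groupV groupX | apply/shiftsV/expS].
have class_RR (g : [subg RR]) : exists v, shifts (val g) v.
  (* The permutations that translate the potential form a subgroup containing the generators. *)
  have shiftable : group_set [set h | `[< exists v, shifts h v >]].
    apply/group_setP; split; first by rewrite inE; apply/asboolP; exists 0.
    move=> h1 h2; rewrite !inE => /asboolP[v1 S1] /asboolP[v2 S2].
    by apply/asboolP; exists (v1 + v2); apply: shiftsM.
  have: RR \subset Group shiftable.
    rewrite gen_subG; apply/subsetP=> _ /imsetP[x _ ->]; rewrite inE.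
    by apply/asboolP; eexists; apply: shifts_chip.
  by move/subsetP/(_ _ (valP g)); rewrite inE => /asboolP.
have [f fP] := choice RR_class; have [h hP] := choice class_RR.
exists f; split=> [v w|].
  apply: val_inj; apply: shifts_perm (fP _) _.
  by rewrite [val _]sgvalM ?inE //; apply: shiftsM; apply: fP.
exists h => [v|g]; first exact: shifts_class (hP _) (fP _).
by apply: val_inj; apply: shifts_perm (fP _) (hP _).
Qed.
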